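(* Let $X\subseteq\mathbb{R}^d$ be compact and convex, let $f$ be lower semi-continuous on $X\times\Delta$ and such that $f(\cdot,\delta)$ is convex on $X$ for every $\delta\in\Delta$, and suppose there exists $x\in X$ with $f(x,\delta)\le 0$ for all $\delta\in\Delta$. Suppose there is a strictly increasing function $\varphi:\mathbb{R}^+\to[0,1]$ such that $\mathbb{P}\{\mathbb{B}_r(\delta)\cap\Delta\}\ge\varphi(r)$ for all $\delta\in\mathrm{cl}(\Delta)$ and all $r\in\mathbb{R}^+$. Assume there exists a constant $L_g\ge 0$ such that for all $\omega=(\delta_1,\dots,\delta_d)$ and $\omega'=(\delta_1',\dots,\delta_d')$ in $\mathrm{cl}(\Delta)^d$, $$|g_d(\omega)-g_d(\omega')|\le L_g\max_{i\in\{1,\dots,d\}}\|\delta_i-\delta_i'\| .$$ Let $N\ge d$ be an integer and let $\omega_N$ be a vector of $N$ i.i.d. samples drawn according to $\mathbb{P}$. Then for any $\epsilon\in(0,1)$ for which $\varphi^{-1}(\epsilon)$ is defined, $$\mathbb{P}^N\{\omega_N\in\Delta^{N}: J^\star\le g_N(\omega_N)+L_g\,\varphi^{-1}(\epsilon)\}\ge 1-d(1-\epsilon)^N .$$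
   Context: Setting: $d\ge 1$ is an integer, $c\in\mathbb{R}^d$, $X\subseteq\mathbb{R}^d$, $\Delta\subseteq\mathbb{R}^m$ is nonempty, and $\mathrm{cl}(\Delta)$ is its closure in $\mathbb{R}^m$. The function $f$ is real-valued and defined on $X\times\mathrm{cl}(\Delta)$. $(\Delta,\mathcal{B}(\Delta),\mathbb{P})$ is a probability space with $\mathcal{B}(\Delta)$ the Borel $\sigma$-algebra of $\Delta$ and $\mathbb{P}$ having support $\Delta$; $\mathbb{P}^N$ is the product measure on $\Delta^N$. $\mathbb{R}^+=[0,\infty)$, $\|\cdot\|$ is the Euclidean norm, and $\mathbb{B}_r(\delta)$ is the open ball centered at $\delta$ with radius $r$. Robust convex program: $J^\star:=\inf\{c^\top x: x\in X,\ f(x,\delta)\le 0\ \forall\delta\in\Delta\}$. Scenario program value: for an integer $k\geq 1$ and $\omega=(\delta_1,\dots,\delta_k)\in\mathrm{cl}(\Delta)^k$, $g_k(\omega):=\inf\{c^\top x: x\in X,\ f(x,\delta_i)\le 0,\ i=1,\dots,k\}$. The Lipschitz hypothesis on $g_d$ includes that $g_d$ is finite on $\mathrm{cl}(\Delta)^d$. $\varphi^{-1}$ is the inverse of the strictly increasing (hence injective) function $\varphi$, defined on the range $\varphi(\mathbb{R}^+)$. *)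

(* Defs.v *)
From HB Require Import structures.
From mathcomp Require Import all_boot all_order all_algebra.
From mathcomp Require Import all_classical all_reals all_analysis.

Set Implicit Arguments.
Unset Strict Implicit.
Unset Printing Implicit Defensive.

Import Order.TTheory GRing.Theory Num.Theory.
Import numFieldNormedType.Exports.

Local Open Scope classical_set_scope.
Local Open Scope ring_scope.

(* The library norm [`|_|] on matrices is the sup norm.  It induces the same
   topology, so closures, compactness and Borel sets are unaffected. *)
Definition enorm (R : realType) (n : nat) (v : 'cV[R]_n) : R :=
  Num.sqrt (\sum_(i < n) v i 0 ^+ 2).

Definition eball (R : realType) (n : nat) (v : 'cV[R]_n) (r : R) :
    set 'cV[R]_n :=
  [set u | enorm (u - v) < r].

Definition dotp (R : realType) (n : nat) (c x : 'cV[R]_n) : R :=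
  (c^T *m x) 0 0.

(* Infima are taken in [\bar R]: the value of an infeasible program is [+oo]. *)
Definition robust_value (R : realType) (d m : nat) (c : 'cV[R]_d)
    (X : set 'cV[R]_d) (f : 'cV[R]_d -> 'cV[R]_m -> R)
    (Delta : set 'cV[R]_m) : \bar R :=
  ereal_inf [set (dotp c x)%:E |
    x in [set x | X x /\ forall delta, Delta delta -> f x delta <= 0]].

Definition scenario_value (R : realType) (d m : nat) (c : 'cV[R]_d)
    (X : set 'cV[R]_d) (f : 'cV[R]_d -> 'cV[R]_m -> R)
    (k : nat) (w : 'I_k -> 'cV[R]_m) : \bar R :=
  ereal_inf [set (dotp c x)%:E |
    x in [set x | X x /\ forall i : 'I_k, f x (w i) <= 0]].

(* Points of [D], with the topology induced by [T].  Measurable types of the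
   library are pointed, hence the nonemptiness argument; the chosen point plays
   no other role. *)
Definition relspace (T : topologicalType) (D : set T) (D0 : D !=set0) : Type :=
  set_type D.

Section relspace_instances.
Context (T : topologicalType) (D : set T) (D0 : D !=set0).

HB.instance Definition _ := Topological.copy (relspace D0) (set_type D).

HB.instance Definition _ := isPointed.Build (relspace D0)
  (SigSub (mem_set (projT2 (cid D0))) : set_type D).

Definition relval (x : relspace D0) : T := set_val (x : set_type D).

End relspace_instances.

Arguments relval {T D} D0 x.

(* [D] need not be a Borel subset of [T], so the sigma-algebra lives on the
   points of [D] rather than on [T]. *)
Definition borel_space (T : topologicalType) (D : set T) (D0 : D !=set0) :=
  g_sigma_algebraType (@open (relspace D0)).

Definition msupport (R : realType) (T : topologicalType) (D : set T)
    (D0 : D !=set0) (P : probability (borel_space D0) R) :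
    set (relspace D0) :=
  [set x | forall U : set (relspace D0), open U -> U x -> (0 < P U)%E].

Definition tcons (T : Type) (n : nat) (p : T * n.-tuple T) : n.+1.-tuple T :=
  [tuple of p.1 :: p.2].

Section power_probability.
Context d (T : measurableType d) (R : realType) (P : probability T R).

Lemma measurable_tcons (n : nat) : measurable_fun setT (@tcons T n).
Proof. exact: measurable_cons. Qed.

HB.instance Definition _ (n : nat) :=
  isMeasurableFun.Build _ _ _ _ (@tcons T n) (@measurable_tcons n).

Fixpoint power_probability (n : nat) : probability (n.-tuple T) R :=
  match n with
  | 0%N => dirac [tuple]
  | n'.+1 => distribution (P \x power_probability n')%E (@tcons T n')
  end.

Lemma measurable_box (n : nat) (A : 'I_n -> set T) :
  (forall i, measurable (A i)) ->
  measurable [set t : n.-tuple T | forall i, A i (tnth t i)].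
Proof.
move=> mA.
have -> : [set t : n.-tuple T | forall i, A i (tnth t i)] =
    \bigcap_(i in [set: 'I_n]) (@tnth n T ^~ i @^-1` A i).
  by apply/seteqP; split=> [t At i _|t At i]; [exact: At|exact: (At i)].
apply: fin_bigcap_measurable => // i _.
by have := measurable_tnth i measurableT (mA i); rewrite setTI.
Qed.

(* [power_probability] is the N-fold product: together with the fact that boxes
   form a pi-system generating the sigma-algebra of [n.-tuple T], this identity
   characterises it. *)
Lemma power_probability_box (n : nat) (A : 'I_n -> set T) :
  (forall i, measurable (A i)) ->
  power_probability n [set t | forall i, A i (tnth t i)] =
  (\prod_(i < n) P (A i))%E.
Proof.
elim: n A => [|n IH] A mA.
  rewrite big_ord0 /= diracE mem_set//=; by case.
rewrite big_ord_recl /= /distribution /pushforward.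
have -> : tcons (n:=n) @^-1` [set t | forall i, A i (tnth t i)] =
   A ord0 `*` [set t : n.-tuple T | forall i, A (lift ord0 i) (tnth t i)].
  apply/seteqP; split=> -[x t] /=.
    move=> At; split; first by have := At ord0; rewrite tnth0.
    by move=> i; have := At (lift ord0 i); rewrite tnthS.
  move=> [Ax At] i; case: (unliftP ord0 i) => [j|] ->.
    by rewrite tnthS.
  by rewrite tnth0.
have mB := measurable_box (fun i => mA (lift ord0 i)).
rewrite product_measure1E//; congr (_ * _)%E.
exact: (IH (fun i => A (lift ord0 i))).
Qed.

End power_probability.

(* Main.v *)
Require Import Defs.
From mathcomp Require Import all_boot all_order all_algebra.
From mathcomp Require Import all_classical all_reals all_analysis.
From mathcomp Require Import ring lra.

Import Order.TTheory GRing.Theory Num.Theory.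
Import numFieldNormedType.Exports.

Local Open Scope classical_set_scope.
Local Open Scope ring_scope.

(* For a < J*, compactness of X and Helly's theorem produce d points w of Delta
   with g_d(w) >= a.  If every ball of radius r = phi^-1(eps) around a point w_i
   contains a sample, then dropping the other constraints and using the
   Lipschitz bound gives g_N(omega) >= g_d(w) - L_g r >= a - L_g r.  Each ball
   is missed with probability at most (1 - eps)^N, so the union bound applies;
   letting a increase to J* and using continuity of the measure from above
   avoids the question whether the supremum of g_d over Delta^d is attained.
   The events {a < g_N} are measurable because g_N is lower semicontinuous and
   the topology of Delta has a countable base of rational balls. *)

(** * Convex combinations, Radon's theorem and Helly's theorem *)

Lemma convex_setP (R : numDomainType) (V : lmodType R) (C : set V) (x y : V)
    (a b : R) : convex_set C -> C x -> C y -> 0 <= a -> 0 <= b -> a + b = 1 ->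
  C (a *: x + b *: y).
Proof.
move=> convC Cx Cy a0 b0 ab1.
have a01 : 0 <= a <= 1 by rewrite a0 -ab1 lerDl.
pose k : {i01 R} := Itv01 a0 (proj2 (andP a01)).
have /(_ k (mem_set Cx) (mem_set Cy)) := convC x y.
rewrite inE; congr (C _).
rewrite /conv /=; congr (_ + _ *: _).
by rewrite /unstable.onem; apply/eqP; rewrite subr_eq addrC ab1.
Qed.

(* Homogeneous form of stability under convex combinations: normalising the
   weights only once keeps the induction free of divisions by partial sums. *)
Lemma convex_set_sum (R : numFieldType) (V : lmodType R) (C : set V)
    (I : Type) (s : seq I) (l : I -> R) (x : I -> V) :
  convex_set C -> (forall i, 0 <= l i) -> (forall i, 0 < l i -> C (x i)) ->
  0 < \sum_(i <- s) l i ->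
  C ((\sum_(i <- s) l i)^-1 *: \sum_(i <- s) l i *: x i).
Proof.
move=> convC l0 Cx; elim: s => [|i s IH]; first by rewrite big_nil ltxx.
rewrite !big_cons; set t := \sum_(j <- s) l j in IH *.
set z := \sum_(j <- s) _ *: _ in IH *.
have t0 : 0 <= t by exact: sumr_ge0.
(* A zero tail weight forces every tail term to vanish, so the average is [x i] itself. *)
have [tE|tN] := eqVneq t 0.
  have -> : z = 0.
    rewrite /z; rewrite {IH z}/t in tE t0 *.
    elim: s tE {t0} => [|j s IH]; first by rewrite !big_nil.
    rewrite !big_cons => /eqP.
    rewrite paddr_eq0 ?sumr_ge0// => /andP[/eqP -> /eqP /IH ->].
    by rewrite scale0r addr0.
  rewrite tE !addr0 => li0; rewrite scalerA mulVf ?gt_eqF// scale1r.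
  exact: Cx.
have tp : 0 < t by rewrite lt_neqAle eq_sym tN.
have [liE|liN] := eqVneq (l i) 0.
  by rewrite liE scale0r !add0r => _; exact: IH.
have lip : 0 < l i by rewrite lt_neqAle eq_sym liN l0.
move=> sp.
(* The new average is a two-point combination of [x i] and the normalised tail. *)
have -> : (l i + t)^-1 *: (l i *: x i + z) =
    (l i / (l i + t)) *: x i + (t / (l i + t)) *: (t^-1 *: z).
  rewrite scalerDr !scalerA; congr (_ *: _ + _ *: _); first exact: mulrC.
  by field; rewrite !gt_eqF.
apply: convex_setP => //; first exact: Cx.
- exact: IH.
- by rewrite divr_ge0// ltW.
- by rewrite divr_ge0// ltW.
- by rewrite -mulrDl divff// gt_eqF.
Qed.

(** The matrix with rows [(1, x_i^T)] has rank at most [d.+1 < n], so its left kernel is nonzero;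
    the column of ones makes the coefficients sum to zero. *)
Lemma affine_dependence (R : fieldType) (d n : nat) (x : 'I_n -> 'cV[R]_d) :
  (d.+1 < n)%N ->
  exists l : 'I_n -> R, [/\ exists i, l i != 0, \sum_i l i = 0 &
    \sum_i l i *: x i = 0].
Proof.
move=> dn; pose M : 'M[R]_(n, 1 + d) := row_mx (const_mx 1) (\matrix_i (x i)^T).
have : kermx M != 0.
  rewrite -mxrank_eq0 mxrank_ker subn_eq0 -ltnNge.
  by apply: leq_ltn_trans (rank_leq_col _) _; rewrite add1n.
case/rowV0Pn => v /sub_kermxP vM /rV0Pn[i vi0].
exists (v 0); split; first by exists i.
- have := congr1 (fun A => lsubmx A 0 0) vM.
  rewrite mul_mx_row row_mxKl !mxE.
  by under eq_bigr do rewrite mxE mulr1.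
- apply/colP => k; have := congr1 (fun A => rsubmx A 0 k) vM.
  rewrite mul_mx_row row_mxKr summxE !mxE => E; rewrite -[RHS]E.
  by apply: eq_bigr => j _; rewrite !mxE.
Qed.

(** The positive part [a] and the negative part [b] of an affine dependence give two expressions of
    one point. For each [j], one of them puts no weight on [x j], the only point that may lie
    outside [C j]. *)
Lemma radon (R : realFieldType) (d n : nat) (C : 'I_n -> set 'cV[R]_d)
    (x : 'I_n -> 'cV[R]_d) :
  (d.+1 < n)%N -> (forall i, convex_set (C i)) ->
  (forall i j, i != j -> C j (x i)) -> exists p, forall i, C i p.
Proof.
move=> dn convC Cx; have [l [[k lk] l0 lx0]] := affine_dependence _ _ _ x dn.
pose a i := Num.max (l i) 0; pose b i := Num.max (- l i) 0.
have a0 i : 0 <= a i by rewrite le_max lexx orbT.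
have b0 i : 0 <= b i by rewrite le_max lexx orbT.
have lab i : l i = a i - b i.
  by rewrite /a /b; case: (leP 0 (l i)) => ?; case: (leP 0 (- l i)) => ?; lra.
have sab : \sum_i a i = \sum_i b i.
  by apply/subr0_eq; rewrite -sumrB -[RHS]l0; apply: eq_bigr.
have xab : \sum_i a i *: x i = \sum_i b i *: x i.
  apply/subr0_eq; rewrite -sumrB -[RHS]lx0; apply: eq_bigr => i _.
  by rewrite lab scalerBl.
have sa0 : 0 < \sum_i a i.
  rewrite lt_neqAle sumr_ge0// andbT eq_sym; apply: contraNneq lk => sa.
  have ak : a k = 0 by apply: (psumr_eq0P _ sa).
  have bk : b k = 0 by rewrite sab in sa; apply: (psumr_eq0P _ sa).
  by rewrite lab ak bk subrr.
exists ((\sum_i a i)^-1 *: \sum_i a i *: x i) => j.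
have [lj|lj] := leP (l j) 0.
  apply: convex_set_sum => // i ai; apply: Cx; apply: contraTneq ai => ->.
  by rewrite /a max_r// ltxx.
rewrite xab sab; apply: convex_set_sum => //; last by rewrite -sab.
move=> i bi; apply: Cx; apply: contraTneq bi => ->.
by rewrite /b max_r ?ltxx// oppr_le0 ltW.
Qed.

(** Induction on the number of sets: omitting set [i] leaves a family with a common point [x i], and
    these points satisfy the hypothesis of [radon]. *)
Lemma helly (R : realFieldType) (d n : nat) (C : 'I_n -> set 'cV[R]_d) :
  (forall i, convex_set (C i)) ->
  (forall h : 'I_d.+1 -> 'I_n, exists x, forall j, C (h j) x) ->
  exists x, forall i, C i x.
Proof.
elim: n C => [|n IH] C convC Ch; first by exists 0 => -[].
have [nd|dn] := leqP n d.
  (* There are at most [d.+1] sets: [inord] reaches every index and falls back to [ord0] for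
     [j > n]. *)
  have [x Cx] := Ch (fun j => inord j); exists x => i.
  have id : (i < d.+1)%N by rewrite (leq_trans (ltn_ord i)).
  by have := Cx (Ordinal id); rewrite /= inord_val.
suff /choice[x Cx] : forall i, exists x, forall j, i != j -> C j x.
  by apply: (@radon _ _ _ C x).
move=> i; have [] := IH (C \o lift i).
- by move=> j; exact: convC.
- by move=> h; exact: (Ch (lift i \o h)).
- move=> x Cx; exists x => j ij.
  by case: (unliftP i j) ij => [j' ->|->]; [move=> _; exact: Cx|rewrite eqxx].
Qed.

(** * Continuity of the linear objective and of the Euclidean norm *)

Lemma dotpE (R : realType) (d : nat) (c x : 'cV[R]_d) :
  dotp c x = \sum_i c i 0 * x i 0.
Proof. by rewrite /dotp mxE; apply: eq_bigr => i _; rewrite mxE. Qed.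

Lemma dotpD (R : realType) (d : nat) (c x y : 'cV[R]_d) :
  dotp c (x + y) = dotp c x + dotp c y.
Proof. by rewrite /dotp mulmxDr mxE. Qed.

Lemma dotpZ (R : realType) (d : nat) (c x : 'cV[R]_d) (a : R) :
  dotp c (a *: x) = a * dotp c x.
Proof. by rewrite /dotp -scalemxAr mxE. Qed.

Lemma sum_continuous (R : realType) (T : topologicalType) (n : nat)
    (F : 'I_n -> T -> R) :
  (forall i, continuous (F i)) -> continuous (fun x => \sum_i F i x).
Proof.
move=> cF; have addc : continuous (fun z : R * R => z.1 + z.2).
  by move=> z; exact: add_continuous.
by apply: (continuous_big addc) => i _; exact: cF.
Qed.

Lemma continuous_dotp (R : realType) (d : nat) (c : 'cV[R]_d) :
  continuous (dotp c).
Proof.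
rewrite (_ : dotp c = fun y => \sum_i c i 0 * y i 0); last first.
  by apply/funext => y; rewrite dotpE.
apply/sum_continuous => i y; apply: continuousM; last exact: coord_continuous.
exact: cst_continuous.
Qed.

Lemma continuous_enorm (R : realType) (d : nat) : continuous (@enorm R d).
Proof.
move=> x; apply: (@continuous_comp _ _ _ (fun y : 'cV[R]_d => \sum_i y i 0 ^+ 2)
  Num.sqrt); last exact: sqrt_continuous.
apply/sum_continuous => i y; apply: continuousM; exact: coord_continuous.
Qed.

Lemma open_eball (R : realType) (d : nat) (v : 'cV[R]_d) (r : R) :
  open (eball v r).
Proof.
have -> : eball v r = (fun u => enorm (u - v)) @^-1` [set t | t < r] by [].
apply: open_comp; last exact: open_lt.
move=> u _; apply: (@continuous_comp _ _ _ (fun y : 'cV[R]_d => y - v)).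
  by apply: continuousB; [by []|exact: cst_continuous].
exact: continuous_enorm.
Qed.

(** * Compactness and lower semicontinuity: finitely many constraints, stability of scenario
    values *)

Lemma lte_between (R : realFieldType) (a : R) (y : \bar R) :
  (a%:E < y)%E -> exists2 b : R, a < b & (b%:E < y)%E.
Proof.
case: y => [y| |//]; last by exists (a + 1); rewrite ?ltrDl ?ltry.
by rewrite lte_fin => ay; exists ((a + y) / 2); rewrite ?lte_fin midf_lt.
Qed.

Lemma compact_dotp_le (R : realType) (d : nat) (c : 'cV[R]_d)
    (X : set 'cV[R]_d) (a : R) :
  compact X -> compact [set x | X x /\ dotp c x <= a].
Proof.
move=> cX; rewrite (_ : [set x | _] = X `&` (dotp c @^-1` [set t | t <= a]))//.
apply: compact_closedI => //; apply: closed_comp; last exact: closed_le.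
by move=> x _; exact: continuous_dotp.
Qed.

(** Semicontinuity on the subspace says nothing outside the product of [X] and [D]; keeping
    membership inside the property allows neighbourhoods of the ambient space. *)
Lemma lsc_near_gt0 (R : realType) (T U : topologicalType) (X : set T)
    (D : set U) (f : T -> U -> R) (x : T) (u : U) :
  lower_semicontinuous (fun z : subspace (X `*` D) => (f z.1 z.2)%:E) ->
  X x -> D u -> 0 < f x u ->
  \forall x' \near x & u' \near u, X x' -> D u' -> 0 < f x' u'.
Proof.
move=> f_lsc Xx Du fxu; have [|V] := f_lsc (x, u) 0; first by rewrite lte_fin.
rewrite /nbhs /= -nbhs_subspace_in// => nV Vf.
apply: filterS (nV : nbhs (x, u) _) => -[x' u'] /= + Xx' Du'.
by move=> /(_ (conj Xx' Du'))/Vf; rewrite lte_fin.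
Qed.

Lemma violated_finitely (R : realType) (d m : nat) (K X : set 'cV[R]_d)
    (D : set 'cV[R]_m) (f : 'cV[R]_d -> 'cV[R]_m -> R) :
  lower_semicontinuous (fun z : subspace (X `*` D) => (f z.1 z.2)%:E) ->
  compact K -> K `<=` X -> (forall x, K x -> exists2 u, D u & 0 < f x u) ->
  exists (n : nat) (u : 'I_n -> 'cV[R]_m),
    (forall i, D (u i)) /\ forall x, K x -> exists i, 0 < f x (u i).
Proof.
move=> f_lsc cK KX Kf.
(* The premise [X x] puts all points outside [X] into the set, so for [u] in [D] its ambient
   interior contains every point of [X] that violates constraint [u]. *)
pose F u := [set x | X x -> 0 < f x u]^°.
have : finite_subset_cover D F K.
  move: cK; rewrite compact_cover; apply => [u _|x Kx].
    exact: open_interior.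
  have [u Du fxu] := Kf _ Kx; exists u => //.
  have := lsc_near_gt0 _ _ _ _ _ _ _ _ f_lsc (KX _ Kx) Du fxu.
  case=> -[A B] /= [nA nB] AB; apply: filterS nA => y Ay Xy.
  by apply: (AB (y, u)) => //; split=> //; exact: nbhs_singleton.
case=> s sD Ks.
exists (size (finmap.enum_fset s)), (tnth (in_tuple (finmap.enum_fset s))).
split=> [i|x Kx].
  by have /sD := mem_tnth i (in_tuple (finmap.enum_fset s)); rewrite inE.
have [u /= us /interior_subset /(_ (KX _ Kx)) fxu] := Ks _ Kx.
have /tnthP[i ui] : u \in in_tuple (finmap.enum_fset s) by [].
by exists i; rewrite -ui.
Qed.

Lemma convex_set_sublevel (R : realType) (d : nat) (X : set 'cV[R]_d)
    (h : 'cV[R]_d -> R) (a : R) :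
  convex_set X -> convex_function X h -> convex_set [set x | X x /\ h x <= a].
Proof.
move=> cX ch x y l; rewrite !inE => -[Xx hx] [Xy hy]; split.
  by have := cX x y l (mem_set Xx) (mem_set Xy); rewrite inE.
apply: le_trans (ch l _ _ (mem_set Xx) (mem_set Xy)) _.
have l0 : 0 <= l%:num :> R by [].
have l1 : 0 <= 1 - l%:num :> R by rewrite subr_ge0.
rewrite convRE /= /unstable.onem; nra.
Qed.

Lemma convex_function_dotp (R : realType) (d : nat) (X : set 'cV[R]_d)
    (c : 'cV[R]_d) : convex_function X (dotp c).
Proof. by move=> l x y _ _; rewrite convRE /conv /= dotpD !dotpZ. Qed.

(* Helly applied to the finitely many violated constraints together with the
   halfspace [dotp c x <= a]: the robust feasible point forces that halfspace
   into every empty subfamily of size [d.+1], leaving [d] constraints. *)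
Lemma scenario_value_approx (R : realType) (d m : nat) (c : 'cV[R]_d)
    (X : set 'cV[R]_d) (D : set 'cV[R]_m) (f : 'cV[R]_d -> 'cV[R]_m -> R)
    (a : R) :
  D !=set0 -> compact X -> convex_set X ->
  lower_semicontinuous (fun z : subspace (X `*` D) => (f z.1 z.2)%:E) ->
  (forall u, D u -> convex_function X (f ^~ u)) ->
  (exists2 x, X x & forall u, D u -> f x u <= 0) ->
  (a%:E < robust_value c X f D)%E ->
  exists2 w : 'I_d -> 'cV[R]_m,
    (forall i, D (w i)) & (a%:E <= scenario_value c X f w)%E.
Proof.
move=> [u0 Du0] cptX cvxX f_lsc f_cvx [x0 Xx0 fx0] aJ.
have [] := @violated_finitely R d m [set x | X x /\ dotp c x <= a] X D f.
- exact: f_lsc.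
- exact: compact_dotp_le.
- by move=> x [].
- move=> x [Xx cxa]; apply: contrapT => nfx.
  have : (robust_value c X f D <= a%:E)%E.
    apply: ge_ereal_inf; exists (dotp c x)%:E; last by rewrite lee_fin.
    exists x => //; split=> // u Du; rewrite leNgt; apply/negP => fxu.
    by apply: nfx; exists u.
  by rewrite leNgt aJ.
move=> n [u [Du Ku]].
pose C (i : 'I_n.+1) : set 'cV[R]_d :=
  if unlift ord0 i is Some j then [set x | X x /\ f x (u j) <= 0]
  else [set x | X x /\ dotp c x <= a].
have cC i : convex_set (C i).
  rewrite /C; case: unliftP => [j _|_]; apply: convex_set_sublevel => //.
    exact: f_cvx.
  exact: convex_function_dotp.
(* By [Ku] the whole family has no common point, so Helly yields [d.+1] indices whose sets already
   have none. *)
have /existsNP[h Ch] : ~ forall h : 'I_d.+1 -> 'I_n.+1,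
    exists x, forall j, C (h j) x.
  move=> /(helly _ _ _ _ cC)[x Cx].
  have := Cx ord0; rewrite /C unlift_none => -[Xx cxa].
  have [i fi] := Ku x (conj Xx cxa); have := Cx (lift ord0 i).
  by rewrite /C liftK => -[_]; rewrite leNgt fi.
have [j0 hj0] : exists j, h j = ord0.
  apply: contrapT => /forallNP hN; apply: Ch; exists x0 => j.
  rewrite /C; case: unliftP => [i _|/hN//].
  by split=> //; exact: fx0.
(* Dropping position [j0] leaves [d] indices. Where [h] takes the value [ord0] again, the set is the
   same halfspace and [u0] is a filler constraint. *)
pose w (i : 'I_d) := if unlift ord0 (h (lift j0 i)) is Some j then u j else u0.
exists w => [i|].
  by rewrite /w; case: unlift.
apply: le_ereal_inf_tmp => _ [x [Xx fxw] <-]; rewrite lee_fin leNgt.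
apply/negP => cxa; apply: Ch; exists x => j.
have [i ->|->] := unliftP j0 j; last first.
  by rewrite hj0 /C unlift_none; split=> //; exact: ltW.
have := fxw i; rewrite /w /C; case: unliftP => [k _|_] fxk; split=> //.
exact: ltW.
Qed.

(** For [b] strictly between [a] and the value at [w], the points of [X] of cost at most [b] all
    violate a constraint, and locally still do so after a small perturbation of [w]; compactness
    makes the size of the perturbation uniform. *)
Lemma scenario_value_lsc (R : realType) (d m k : nat) (c : 'cV[R]_d)
    (X : set 'cV[R]_d) (D : set 'cV[R]_m) (f : 'cV[R]_d -> 'cV[R]_m -> R)
    (a : R) (w : 'I_k -> 'cV[R]_m) :
  compact X ->
  lower_semicontinuous (fun z : subspace (X `*` D) => (f z.1 z.2)%:E) ->
  (forall i, D (w i)) -> (a%:E < scenario_value c X f w)%E ->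
  exists2 e : R, 0 < e & forall w' : 'I_k -> 'cV[R]_m,
    (forall i, D (w' i)) -> (forall i, ball (w i) e (w' i)) ->
    (a%:E < scenario_value c X f w')%E.
Proof.
move=> cptX f_lsc Dw /lte_between[b ab bg].
have := compact_dotp_le _ _ c _ b cptX.
move/(compact_near_coveringP _).1/near_covering_withinP.
set K := [set x | _].
pose Q (e : R) x := forall w' : 'I_k -> 'cV[R]_m, (forall i, D (w' i)) ->
  (forall i, ball (w i) e (w' i)) -> exists i, 0 < f x (w' i).
move=> /(_ _ (0^'+) Q _) covK.
have : \forall e \near 0^'+, K `<=` Q e.
  apply: covK => x [Xx cxb].
  have [i fi] : exists i, 0 < f x (w i).
    apply: contrapT => nf; suff : (scenario_value c X f w <= b%:E)%E.
      by rewrite leNgt bg.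
    apply: ge_ereal_inf; exists (dotp c x)%:E; last by rewrite lee_fin.
    exists x => //; split=> // i; rewrite leNgt; apply/negP => fi.
    by apply: nf; exists i.
  have [[A B] /= [nA /nbhs_ballP[e /= e0 eB]] AB] :=
    lsc_near_gt0 _ _ _ _ _ _ _ _ f_lsc Xx (Dw i) fi.
  exists (A, [set e' | e' < e]) => /=.
    by split=> //; exact: nbhs_right_lt.
  move=> [x' e'] /= [Ax' e'e] [Xx' _] w' Dw' bw'; exists i.
  have Bw' : B (w' i) by apply: eB; apply: (le_ball (ltW e'e)); exact: bw'.
  exact: (AB (x', w' i) (conj Ax' Bw') Xx' (Dw' i)).
move=> nQ; have [e [e0 KQ]] := filter_ex (filterI (nbhs_right_gt 0) nQ).
(* The perturbed value is bounded below by [b] only weakly; [a < b] restores strictness. *)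
exists e => // w' Dw' bw'; apply: lt_le_trans (_ : (b%:E <= _)%E).
  by rewrite lte_fin.
apply: le_ereal_inf_tmp => _ [x [Xx fxw] <-]; rewrite lee_fin leNgt.
apply/negP => cxb; have [i] := KQ x (conj Xx (ltW cxb)) w' Dw' bw'.
by rewrite ltNge fxw.
Qed.

(** * Measurability and probability of events on sample tuples *)

Lemma measurable_relval_preimage (T : topologicalType) (D : set T)
    (D0 : D !=set0) (U : set T) :
  open U -> measurable (relval D0 @^-1` U : set (borel_space D0)).
Proof. by move=> oU; apply: sub_sigma_algebra; exists U. Qed.

(** Such a set is a countable union of the boxes it contains, with rational centres and radii
    [k.+1%:R^-1]; these boxes are measurable for the product sigma-algebra. *)
Lemma measurable_tuple_open (R : realType) (m n : nat) (D : set 'cV[R]_m)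
    (D0 : D !=set0) (S : set (n.-tuple (borel_space D0))) :
  (forall w, S w -> exists2 e : R, 0 < e & forall w' : n.-tuple (borel_space D0),
     (forall i, ball (relval D0 (tnth w i)) e (relval D0 (tnth w' i))) ->
     S w') ->
  measurable S.
Proof.
move=> S_open.
pose A (p : (n.-tuple 'cV[rat]_m * nat)%type) i : set (borel_space D0) :=
  relval D0 @^-1` ball (map_mx ratr (tnth p.1 i) : 'cV[R]_m) p.2.+1%:R^-1.
pose B p := [set w : n.-tuple (borel_space D0) | forall i, A p i (tnth w i)].
have mB p : measurable (B p).
  apply: (@measurable_box _ _ _ (A p)) => i.
  by apply: measurable_relval_preimage; exact: ball_open.
pose F p := if `[< B p `<=` S >] then B p else set0.
have -> : S = \bigcup_p F p.
  apply/seteqP; split=> [w Sw|w [p _]]; last first.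
    by rewrite /F; case: asboolP => // BS /BS.
  have [e e0 eS] := S_open _ Sw.
  have [k ke] : exists k : nat, k.+1%:R^-1 < e / 2.
    have := near_infty_natSinv_lt (PosNum (divr_gt0 e0 (ltr0n R 2))).
    by case=> k _ /(_ k (leqnn k)) /=; exists k.
  set t : R := k.+1%:R^-1 in ke *.
  have t0 : 0 < t by rewrite invr_gt0.
  have /choice[q qw] : forall i, exists q : 'cV[rat]_m,
      ball (map_mx ratr q : 'cV[R]_m) t (relval D0 (tnth w i)).
    move=> i; set x := relval D0 _.
    have /choice[q qx] : forall j, exists q : rat, `|ratr q - x j 0| < t.
      move=> j; have [|q] := @rat_in_itvoo R (x j 0 - t) (x j 0 + t).
        by rewrite ltrBlDr -addrA ltrDl addr_gt0.
      by rewrite in_itv /= => qx; exists q; rewrite ltr_distl.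
    exists (\col_j q j); split=> // j j'; rewrite ord1 !mxE /ball /=.
    exact: qx.
  exists ([tuple q i | i < n], k) => //; rewrite /F.
  case: asboolP => [_ i|[]]; first by rewrite /A /= tnth_mktuple; exact: qw.
  move=> w' Bw'; apply: eS => i; apply: (@le_ball _ _ _ (t + t)).
    by rewrite [leRHS]splitr lerD ?ltW.
  apply: ball_triangle (Bw' i); apply: ball_sym.
  by rewrite tnth_mktuple; exact: qw.
apply: countable_bigcupT_measurable => [|p]; first exact: countableP.
by rewrite /F; case: ifP.
Qed.

(** The complement is the union over [i] of the boxes where all [N] samples miss [B i]. Each box has
    probability at most [(1 - eps) ^+ N], and the union bound adds up [d] of them. *)
Lemma power_probability_hit (dT : measure_display) (T : measurableType dT)
    (R : realType) (P : probability T R) (d N : nat) (B : 'I_d -> set T)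
    (eps : R) :
  (forall i, measurable (B i)) -> (forall i, (eps%:E <= P (B i))%E) ->
  eps <= 1 ->
  let G := [set w : N.-tuple T | forall i, exists j, B i (tnth w j)] in
  measurable G /\ ((1 - d%:R * (1 - eps) ^+ N)%:E <= power_probability P N G)%E.
Proof.
move=> mB PB eps1 G.
(* The events are indexed by [nat], as the union bound expects, and are empty from [d] on. *)
pose F (k : nat) : set (N.-tuple T) :=
  if insub k is Some i then [set w | forall j, (~` B i) (tnth w j)] else set0.
have mF k : measurable (F k).
  rewrite /F; case: insub => // i.
  by apply: (@measurable_box _ _ _ (fun=> ~` B i)) => _; exact: measurableC.
have GF : ~` G = \big[setU/set0]_(k < d) F k.
  rewrite -bigcup_mkord; apply/seteqP; split=> w.
    move=> /existsNP[i /forallNP iw]; exists i => //=.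
    by rewrite /F valK.
  move=> [k /= kd]; rewrite /F insubT /= => Fw /(_ (Sub k kd))[j].
  exact: Fw.
have mG : measurable G.
  by rewrite -[G]setCK GF; apply: measurableC; exact: bigsetU_measurable.
split=> //.
have PF k : (power_probability P N (F k) <= ((1 - eps) ^+ N)%:E)%E.
  have pow_ge0 : 0 <= (1 - eps) ^+ N by rewrite exprn_ge0// subr_ge0.
  rewrite /F; case: insub => [i|]; last by rewrite measure0 lee_fin.
  rewrite (@power_probability_box _ _ _ P N (fun=> ~` B i)) => [|_]; last first.
    exact: measurableC.
  rewrite probability_setC//.
  have /fineK PBE := fin_num_measure P (B i) (mB i).
  have := PB i; have := probability_le1 P (mB i).
  rewrite -PBE !lee_fin -EFinB => ? ?.
  rewrite prodEFin prodr_const card_ord lee_fin lerXn2r ?nnegrE; lra.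
rewrite -[G]setCK probability_setC; last exact: measurableC.
rewrite EFinB; apply: leeB => //; rewrite GF.
apply: le_trans (Boole_inequality _ _) _.
  by move=> i _; exact: mF.
apply: (@le_trans _ _ (\sum_(k < d) ((1 - eps) ^+ N)%:E)%E).
  by apply: lee_sum => i _; exact: PF.
by rewrite sumEFin sumr_const card_ord mulr_natl.
Qed.

Lemma relval_in (T : topologicalType) (D : set T) (D0 : D !=set0)
    (x : relspace D0) : D (relval D0 x).
Proof. by rewrite /relval; apply: set_valP. Qed.

Lemma scenario_value_reindex (R : realType) (d m k n : nat) (c : 'cV[R]_d)
    (X : set 'cV[R]_d) (f : 'cV[R]_d -> 'cV[R]_m -> R) (w : 'I_n -> 'cV[R]_m)
    (h : 'I_k -> 'I_n) :
  (scenario_value c X f (w \o h) <= scenario_value c X f w)%E.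
Proof.
apply: ereal_inf_le_tmp => _ [x [Xx fx] <-]; exists x => //.
by split=> // i; exact: fx.
Qed.

(** Continuity from above; it serves to let the threshold on the scenario value increase to its
    limit. *)
Lemma le_measure_bigcap (dT : measure_display) (T : measurableType dT)
    (R : realType) (P : probability T R) (S : nat -> set T) (b : \bar R) :
  (forall n, measurable (S n)) -> {homo S : n m / (n <= m)%N >-> m `<=` n} ->
  (forall n, (b <= P (S n))%E) -> (b <= P (\bigcap_n S n))%E.
Proof.
move=> mS Sdec bS.
have mI : measurable (\bigcap_n S n) by exact: bigcap_measurable.
have cvgS : (P \o S) x @[x --> \oo] --> P (\bigcap_n S n).
  apply: nonincreasing_cvg_mu => //.
    by rewrite (le_lt_trans (probability_le1 _ _)) ?ltry.
  by move=> n k nk; apply/subsetPset; exact: Sdec.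
rewrite -(cvg_lim _ cvgS)//; apply: lime_ge; last exact: nearW.
by apply/cvg_ex; eexists; exact: cvgS.
Qed.

Theorem theorem2 (R : realType) (d m : nat) (d_ge1 : (1 <= d)%N)
    (c : 'cV[R]_d) (X : set 'cV[R]_d)
    (Delta : set 'cV[R]_m) (Delta_neq0 : Delta !=set0)
    (f : 'cV[R]_d -> 'cV[R]_m -> R)
    (P : probability (borel_space Delta_neq0) R)
    (P_support : msupport P = setT)
    (X_compact : compact X) (X_convex : convex_set X)
    (f_lsc : lower_semicontinuous
       (fun z : subspace (X `*` Delta) => (f z.1 z.2)%:E))
    (f_convex : forall delta, Delta delta -> convex_function X (f ^~ delta))
    (feasible : exists2 x, X x & forall delta, Delta delta -> f x delta <= 0)
    (phi : R -> R)
    (phi_range : forall r : R, 0 <= r -> 0 <= phi r <= 1)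
    (phi_incr : forall r s : R, 0 <= r -> r < s -> phi r < phi s)
    (phi_ball : forall (delta : 'cV[R]_m) (r : R),
       closure Delta delta -> 0 <= r ->
       ((phi r)%:E <=
        P (relval Delta_neq0 @^-1` eball delta r))%E)
    (Lg : R) (Lg_ge0 : 0 <= Lg)
    (g_fin : forall w : 'I_d -> 'cV[R]_m, (forall i, closure Delta (w i)) ->
       scenario_value c X f w \is a fin_num)
    (g_lip : forall w w' : 'I_d -> 'cV[R]_m,
       (forall i, closure Delta (w i)) -> (forall i, closure Delta (w' i)) ->
       (`|scenario_value c X f w - scenario_value c X f w'| <=
        (Lg * \big[Num.max/0]_(i < d) enorm (w i - w' i))%:E)%E)
    (N : nat) (dN : (d <= N)%N)
    (eps : R) (eps_gt0 : 0 < eps) (eps_lt1 : eps < 1)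
    (eps_range : (phi @` [set r | 0 <= r]) eps) :
  let E := [set omega : N.-tuple (borel_space Delta_neq0) |
    (robust_value c X f Delta <=
     scenario_value c X f (fun i : 'I_N => relval Delta_neq0 (tnth omega i)) +
     (Lg * 'pinv_(fun=> 0) [set r | 0 <= r] phi eps)%:E)%E] in
  measurable E /\
  ((1 - d%:R * (1 - eps) ^+ N)%:E <= power_probability P N E)%E.

Proof.
move=> E.
have phi_inj : {in [set r | 0 <= r] &, injective phi}.
  move=> s t; rewrite !inE /= => s0 t0 st.
  by have [/(phi_incr _ _ s0)|/(phi_incr _ _ t0)|//] := ltgtP s t;
    rewrite st ltxx.
have [r /= r0 phir] := eps_range.
(* Since [eps] lies in the range of [phi], the default [0] of the partial inverse is never
   reached. *)
have rE : 'pinv_(fun=> 0) [set r | 0 <= r] phi eps = r.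
  by rewrite -phir pinvKV// inE.
rewrite rE in E *; move: (erefl (robust_value c X f Delta)).
(* Feasibility excludes [+oo]; for [-oo] the event is the whole space. *)
case: {2}(robust_value c X f Delta) => [J| |] JE; last 2 first.
- have [x0 Xx0 fx0] := feasible.
  have : (robust_value c X f Delta <= (dotp c x0)%:E)%E.
    by apply: ge_ereal_inf; exists (dotp c x0)%:E => //; exists x0.
  by rewrite JE leye_eq.
- have -> : E = setT.
    by apply/seteqP; split=> // w _; rewrite /E /= JE leNye.
  split; first exact: measurableT.
  rewrite probability_setT lee_fin gerBl mulr_ge0// exprn_ge0//.
  by rewrite subr_ge0 ltW.
pose g (w : N.-tuple (borel_space Delta_neq0)) :=
  scenario_value c X f (fun i : 'I_N => relval Delta_neq0 (tnth w i)).
(* Strict inequalities suit lower semicontinuity; as the slack [n.+1%:R^-1] vanishes, these events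
   decrease to [E]. *)
pose S n := [set w | ((J - Lg * r - n.+1%:R^-1)%:E < g w)%E].
have mS n : measurable (S n).
  apply: measurable_tuple_open => w Sw.
  have [i|e e0 eg] := @scenario_value_lsc _ _ _ _ _ _ _ _ _ _ X_compact f_lsc _ Sw.
    exact: relval_in.
  by exists e => // w' ww'; apply: eg => // i; exact: relval_in.
have PS n : ((1 - d%:R * (1 - eps) ^+ N)%:E <= power_probability P N (S n))%E.
  have n0 : 0 < n.+1%:R^-1 :> R by rewrite invr_gt0.
  (* Only half of the slack is spent on [w]; the other half makes the final inequality strict. *)
  have [|w Dw gw] := @scenario_value_approx R d m c X Delta f
    (J - n.+1%:R^-1 / 2) Delta_neq0 X_compact X_convex f_lsc f_convex feasible.
    by rewrite JE lte_fin gtrBl divr_gt0.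
  pose B i := relval Delta_neq0 @^-1` eball (w i) r.
  have mB i : measurable (B i : set (borel_space Delta_neq0)).
    by apply: measurable_relval_preimage; exact: open_eball.
  have PB i : (eps%:E <= P (B i))%E.
    by rewrite -phir; apply: phi_ball => //; exact: subset_closure.
  have [mG PG] := @power_probability_hit _ _ R P d N B eps mB PB (ltW eps_lt1).
  apply: le_trans PG _; apply: le_measure; rewrite ?inE// => v /choice[h vh].
  (* Sample number [h i] falls in the ball around [w i]; one sample may serve several balls. *)
  pose w' i := relval Delta_neq0 (tnth v (h i)).
  have gv : (scenario_value c X f w' <= g v)%E.
    exact: (@scenario_value_reindex _ _ _ _ _ _ _ _
      (fun i => relval Delta_neq0 (tnth v i)) h).
  rewrite /S /=; apply: lt_le_trans gv.
  have Dw' i : Delta (w' i) by exact: relval_in.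
  have cw i := subset_closure (Dw i); have cw' i := subset_closure (Dw' i).
  move: (g_lip _ _ cw' cw) gw.
  rewrite -(fineK (g_fin _ cw)) -(fineK (g_fin _ cw')).
  rewrite -EFinB abse_EFin !lee_fin lte_fin.
  set M := \big[_/_]_(_ < _) _.
  have Mr : M <= r.
    by apply: bigmax_le => // i _; exact: ltW (vh i).
  have LM : Lg * M <= Lg * r by rewrite ler_wpM2l.
  rewrite ler_norml => /andP[+ _]; move: _^-1 n0 => t t0; lra.
have -> : E = \bigcap_n S n.
  apply/seteqP; split=> w; rewrite /E /= JE -/(g w).
    move=> Jg n _; rewrite /S /=.
    have n0 : 0 < n.+1%:R^-1 :> R by rewrite invr_gt0.
    case: (g w) Jg => [t| |//]; last by rewrite ltry.
    by rewrite -EFinD lee_fin lte_fin; move: _^-1 n0 => s s0; lra.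
  (* Membership at index [0] rules out the value [-oo]; for finite values the slack is taken below
     an arbitrary [e]. *)
  move=> Sw; have := Sw 0%N I; have : forall n, S n w by move=> n; exact: Sw.
  rewrite /S /=; case: (g w) => [t| |] gS _ //;
  last by rewrite leey.
  rewrite -EFinD lee_fin; apply/ler_addgt0Pr => e e0.
  have [k _ /(_ k (leqnn k)) /= ke] := near_infty_natSinv_lt (PosNum e0).
  by have := gS k; rewrite lte_fin; move: _^-1 ke => s se; lra.
split; first exact: bigcap_measurable.
apply: le_measure_bigcap => // n k nk w; rewrite /S /=; apply: le_lt_trans.
by rewrite lee_fin lerD2l lerN2 lef_pV2 ?posrE// ler_nat.
Qed.
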